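(* Let $R$ be an extended affine root system of type $A_1$ of nullity $\nu>1$ in $A$ (as in the context). Then the number of $\mathcal{W}$-orbits of root bases for $R$ is not finite.
   Context: Let $A$ be a free abelian group of rank $\nu+1$ with a symmetric positive semidefinite bi-additive form $(\cdot,\cdot):A\times A\to\mathbb{Q}$ whose radical is $\Lambda$; let $\{\epsilon,\sigma_1,\dots,\sigma_\nu\}$ be a $\mathbb{Z}$-basis of $A$ with $\{\sigma_1,\dots,\sigma_\nu\}$ a $\mathbb{Z}$-basis of $\Lambda$ and $(\epsilon,\epsilon)=2$. For $\alpha\in\pm\epsilon+\Lambda$, $w_\alpha\in\mathrm{Aut}(A)$ is $w_\alpha(\beta)=\beta-\frac{2(\beta,\alpha)}{(\alpha,\alpha)}\alpha$, and $\mathcal{W}=\langle w_\alpha:\alpha\in\pm\epsilon+\Lambda\rangle$. A semilattice in $\Lambda$ is a subset $S\subseteq\Lambda$ with $0\in S$, $S\pm2S\subseteq S$ and $\langle S\rangle=\Lambda$. An extended affine root system of type $A_1$ in $A$ is $R=(S+S)\cup(\pm\epsilon+S)$ for a semilattice $S$ in $\Lambda$; as the paper does (up to isomorphism), assume $\sigma_1,\dots,\sigma_\nu\in S$. Let $S_b=\bigcup_{i=0}^\nu(\sigma_i+2\Lambda)$ with $\sigma_0=0$, and $R_b=(S_b+S_b)\cup(\pm\epsilon+S_b)$, so $R_b\subseteq R$; put $R_b^\times=R_b\setminus\Lambda=\pm\epsilon+S_b$ and $R^0=R\cap\Lambda$. A nonzero $\sigma=\sum_{i=1}^\nu m_i\sigma_i\in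 R^0$ is a strictly positive isotropic root if all $m_i\ge0$. A root basis for $R$ is a $\mathbb{Z}$-basis $\Pi=\{\beta_0,\dots,\beta_\nu\}$ of $A$ contained in $R_b^\times$ such that every strictly positive isotropic root $\sigma\in R$ can be written $\sigma=\sum_{i=0}^\nu m_i\beta_i$ with all $m_i\ge0$. If $\Pi$ is a root basis for $R$ and $w\in\mathcal{W}$, then $w(\Pi)$ is again a root basis for $R$; the $\mathcal{W}$-orbit of $\Pi$ is $\{w(\Pi):w\in\mathcal{W}\}$. *)

(* Defs.v *)
From mathcomp Require Import all_boot all_order all_algebra.
From mathcomp Require Import classical_sets cardinality.

Set Implicit Arguments.
Unset Strict Implicit.
Unset Printing Implicit Defensive.

Import Order.TTheory GRing.Theory Num.Theory.
Local Open Scope classical_set_scope.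
Local Open Scope ring_scope.

(* Uniqueness of the coefficients forces the entries of [b] to be distinct. *)
Definition zbasis_of (A : zmodType) (L : set A) (n : nat) (b : n.-tuple A) :
    Prop :=
  (forall i, L (tnth b i)) /\
  (forall x, L x ->
     exists! m : {ffun 'I_n -> int}, x = \sum_(i < n) tnth b i *~ m i).

Definition zmod_gen (A : zmodType) (S : set A) : set A :=
  smallest [set G : set A | G 0 /\ forall x y, G x -> G y -> G (x - y)] S.

Definition biadditive (A : zmodType) (form : A -> A -> rat) : Prop :=
  (forall y, {morph form^~ y : x x' / x + x'}) /\
  (forall x, {morph form x : y y' / y + y'}).

Definition radical (A : zmodType) (form : A -> A -> rat) : set A :=
  [set x | forall y, form x y = 0].

Definition pm_coset (A : zmodType) (eps : A) (S : set A) : set A :=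
  [set eps + s | s in S] `|` [set - eps + s | s in S].

(* The rational coefficient is an integer for alpha in +-eps + Lambda (see    *)
(* [reflection_coefK]); [numq] recovers that integer so that it acts on A.    *)
Definition reflection (A : zmodType) (form : A -> A -> rat) (alpha beta : A) :
    A :=
  beta - alpha *~ numq (2%:R * form beta alpha / form alpha alpha).

Inductive weyl (A : zmodType) (form : A -> A -> rat) (eps : A) : set (A -> A) :=
| weyl_reflection alpha :
    pm_coset eps (radical form) alpha -> weyl form eps (reflection form alpha)
| weyl_id : weyl form eps id
| weyl_comp f g : weyl form eps f -> weyl form eps g -> weyl form eps (f \o g)
| weyl_inv f g :
    weyl form eps f -> cancel f g -> cancel g f -> weyl form eps g.

Definition semilattice (A : zmodType) (L S : set A) : Prop :=
  [/\ S `<=` L,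
      S 0,
      forall s t, S s -> S t -> S (s + t *+ 2) /\ S (s - t *+ 2)
    & zmod_gen S = L].

Definition root_system (A : zmodType) (eps : A) (S : set A) : set A :=
  [set s + t | s in S & t in S] `|` pm_coset eps S.

(* The union of the sigma_i + 2 Lambda, with sigma_0 = 0 at the head.         *)
Definition base_semilattice (A : zmodType) (L : set A) (nu : nat)
    (sigma : nu.-tuple A) : set A :=
  \bigcup_(s in [set` 0 :: sigma]) [set s + l *+ 2 | l in L].

Definition strictly_positive_isotropic (A : zmodType) (L R : set A) (nu : nat)
    (sigma : nu.-tuple A) : set A :=
  [set x | [/\ (R `&` L) x, x != 0
    & exists2 m : 'I_nu -> int, (forall i, 0 <= m i)
        & x = \sum_(i < nu) tnth sigma i *~ m i]].

Definition root_basis (A : zmodType) (form : A -> A -> rat) (eps : A)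
    (nu : nat) (sigma : nu.-tuple A) (S Pi : set A) : Prop :=
  let L := radical form in
  let R := root_system eps S in
  let Rb := root_system eps (base_semilattice L sigma) in
  exists beta : nu.+1.-tuple A,
    [/\ Pi = [set` beta],
        zbasis_of [set: A] beta,
        Pi `<=` Rb `\` L
      & forall x, strictly_positive_isotropic L R sigma x ->
          exists2 m : 'I_nu.+1 -> int, (forall i, 0 <= m i)
            & x = \sum_(i < nu.+1) tnth beta i *~ m i].

Definition weyl_orbit (A : zmodType) (form : A -> A -> rat) (eps : A)
    (Pi : set A) : set (set A) :=
  [set w @` Pi | w in weyl form eps].

Lemma reflection_coefK (A : zmodType) (form : A -> A -> rat) (nu : nat)
    (eps : A) (sigma : nu.-tuple A) (alpha beta : A) :
  (forall x y, form x y = form y x) -> biadditive form ->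
  zbasis_of [set: A] [tuple of eps :: sigma] ->
  zbasis_of (radical form) sigma -> form eps eps = 2%:R ->
  pm_coset eps (radical form) alpha ->
  let c := 2%:R * form beta alpha / form alpha alpha in (numq c)%:~R = c.
Proof.
move=> symf [addl addr] [_ bA] [sL _] ee alphaP c.
have f0l y : form 0 y = 0.
  by apply: (addrI (form 0 y)); rewrite -addl !addr0.
have fNl x y : form (- x) y = - form x y.
  by apply: (addrI (form x y)); rewrite -addl !subrr f0l.
have fMn x y n : form (x *+ n) y = form x y *+ n.
  by elim: n => [|n IH]; rewrite ?mulr0n ?f0l // !mulrS addl IH.
have fMz x y (m : int) : form (x *~ m) y = form x y *~ m.
  case: m => n; first by rewrite -!pmulrn fMn.
  by rewrite !NegzE !mulrNz fNl -!pmulrn fMn.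
have frad l x : radical form l -> form x l = 0 by rewrite symf; apply.
have [u aa ea] : exists2 u : int, form alpha alpha = 2%:R
    & form eps alpha = u%:~R * 2%:R.
  case: alphaP => -[l lL <-].
  - exists 1.
      by rewrite addr (frad _ _ lL) addr0 addl lL addr0.
    by rewrite addr (frad _ _ lL) addr0 ee mul1r.
  - exists (- 1).
      by rewrite addr (frad _ _ lL) addr0 addl lL addr0 fNl symf fNl opprK.
    by rewrite addr (frad _ _ lL) addr0 symf fNl ee mulN1r.
have [m [bE _]] := bA beta I.
suff [k ->] : exists k : int, c = k%:~R by rewrite numq_int.
exists (m ord0 * u * 2%:R).
rewrite /c aa mulrC mulrA mulVf // mul1r bE big_ord_recl addl tnth0 fMz ea.
have -> : form (\sum_(i < nu) tnth [tuple of eps :: sigma] (lift ord0 i)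
    *~ m (lift ord0 i)) alpha = 0.
  apply: (big_ind (fun x => form x alpha = 0)) => [|x y hx hy|i _].
  - exact: f0l.
  - by rewrite addl hx hy addr0.
  - by rewrite fMz tnthS (sL i) mul0rz.
by rewrite addr0 -mulrzl !intrM mulrA.
Qed.

(* Main.v *)
Require Import Defs.
From mathcomp Require Import all_boot all_order all_algebra.
From mathcomp Require Import classical_sets cardinality.

Set Implicit Arguments.
Unset Strict Implicit.
Unset Printing Implicit Defensive.

Import Order.TTheory GRing.Theory Num.Theory.
Local Open Scope classical_set_scope.
Local Open Scope ring_scope.

(** Every element of the Weyl group is additive, fixes Lambda pointwise and maps
    no element outside Lambda into Lambda, so the set of all sums x + y in
    Lambda of two elements x, y of a root basis only depends on the Weyl orbit
    of that basis ([isotropic_sums_weyl]).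

    A Z-basis tau of Lambda gives the Z-basis eps, - eps + tau_1, ...,
    - eps + tau_nu of A, and the isotropic sums of this basis are exactly the
    tau_i, since tau_i = eps + (- eps + tau_i) while all other sums have
    eps-coordinate 2 or -2 ([isotropic_sums_lifted_basis]).  It is a root basis
    as soon as the tau_i lie in the base semilattice and generate a cone that
    contains every sigma_i ([root_basis_lifted_basis]).

    When nu > 1, there are infinitely many such tau: replace sigma_j by
    sigma_j - 2 k sigma_i with i <> j and k a natural number.  The coset modulo
    2 Lambda is unchanged, and sigma_j = tau_j + 2 k tau_i remains in the cone
    because k is nonnegative.  Different k give different sets of isotropic
    sums, hence different orbits. *)

(** * Integral combinations *)

Definition zcomb (A : zmodType) (n : nat) (b : n.-tuple A) (m : 'I_n -> int) :
    A :=
  \sum_(i < n) tnth b i *~ m i.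

Lemma eq_zcomb (A : zmodType) (n : nat) (b : n.-tuple A) (m m' : 'I_n -> int) :
  m =1 m' -> zcomb b m = zcomb b m'.
Proof. by move=> mm'; apply: eq_bigr => i _; rewrite mm'. Qed.

Lemma zcombB (A : zmodType) (n : nat) (b : n.-tuple A) (m m' : 'I_n -> int) :
  zcomb b (fun i => m i - m' i) = zcomb b m - zcomb b m'.
Proof. by rewrite /zcomb -sumrB; apply: eq_bigr => i _; rewrite mulrzBr. Qed.

Lemma zcomb_single (A : zmodType) (n : nat) (b : n.-tuple A) (i : 'I_n)
    (c : int) :
  zcomb b (fun l => if l == i then c else 0) = tnth b i *~ c.
Proof.
rewrite /zcomb (bigD1 i) //= eqxx big1 ?addr0 // => l /negPf ->.
by rewrite mulr0z.
Qed.

Definition subgroup (A : zmodType) (L : set A) : Prop :=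
  L 0 /\ forall x y, L x -> L y -> L (x - y).

Lemma subgroupMz (A : zmodType) (L : set A) (x : A) (k : int) :
  subgroup L -> L x -> L (x *~ k).
Proof.
move=> [L0 LB] Lx.
have LN y : L y -> L (- y) by move=> Ly; rewrite -sub0r; apply: LB.
have Ln n : L (x *+ n).
  elim: n => [|n IH]; first by rewrite mulr0n.
  by rewrite mulrS -[_ *+ n]opprK; apply: LB => //; apply: LN.
by case: k => n; [apply: Ln | rewrite NegzE mulrNz; apply/LN/Ln].
Qed.

Lemma subgroup_zcomb (A : zmodType) (L : set A) (n : nat) (b : n.-tuple A)
    (m : 'I_n -> int) :
  subgroup L -> (forall i, L (tnth b i)) -> L (zcomb b m).
Proof.
move=> Lg Lb; case: (Lg) => L0 LB.
rewrite /zcomb; apply: big_ind => // [x y Lx Ly|i _]; last exact: subgroupMz.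
by rewrite -[y]opprK -[- y]add0r; apply: (Lg.2) => //; apply: LB.
Qed.

Lemma zbasis_zcomb (A : zmodType) (L : set A) (n : nat) (b : n.-tuple A)
    (x : A) :
  zbasis_of L b -> L x -> exists m, x = zcomb b m.
Proof. by move=> [_ bL] /bL [m [xE _]]; exists m. Qed.

Lemma zcomb_inj (A : zmodType) (L : set A) (n : nat) (b : n.-tuple A)
    (m m' : 'I_n -> int) :
  subgroup L -> zbasis_of L b -> zcomb b m = zcomb b m' -> m =1 m'.
Proof.
move=> Lg [Lb bL] mm' i; have [p [_ pU]] := bL _ (subgroup_zcomb m Lg Lb).
have ffE (q : 'I_n -> int) : zcomb b q = zcomb b m -> p = [ffun i => q i].
  by move=> qE; apply: pU; rewrite -qE; apply: eq_zcomb => l; rewrite ffunE.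
have /ffunP/(_ i) : [ffun i => m i] = [ffun i => m' i].
  by rewrite -ffE // -ffE.
by rewrite !ffunE.
Qed.

Lemma zbasisI (A : zmodType) (L : set A) (n : nat) (b : n.-tuple A) :
  (forall i, L (tnth b i)) ->
  (forall x, L x -> exists m, x = zcomb b m) ->
  (forall m m', zcomb b m = zcomb b m' -> m =1 m') ->
  zbasis_of L b.
Proof.
move=> Lb gen inj; split=> // x /gen [m xE]; exists [ffun i => m i]; split.
  by rewrite xE; apply: eq_zcomb => i; rewrite ffunE.
move=> p xE'; apply/ffunP => i; rewrite ffunE.
by apply: inj; rewrite -xE.
Qed.

(** * Shears of a basis *)

Definition shear (A : zmodType) (n : nat) (b : n.-tuple A) (i j : 'I_n)
    (k : int) : n.-tuple A :=
  [tuple if l == j then tnth b j - tnth b i *~ k else tnth b l | l < n].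

Lemma tnth_shear (A : zmodType) (n : nat) (b : n.-tuple A) (i j : 'I_n)
    (k : int) (l : 'I_n) :
  tnth (shear b i j k) l = tnth b l - tnth b i *~ (if l == j then k else 0).
Proof.
by rewrite tnth_mktuple; case: eqP => [->//|_]; rewrite mulr0z subr0.
Qed.

Lemma zcomb_shear (A : zmodType) (n : nat) (b : n.-tuple A) (i j : 'I_n)
    (k : int) (m : 'I_n -> int) :
  zcomb (shear b i j k) m =
  zcomb b (fun l => m l - (if l == i then k * m j else 0)).
Proof.
rewrite zcombB zcomb_single /zcomb.
under eq_bigr do rewrite tnth_shear mulrzBl -mulrzA.
rewrite sumrB -mulrz_sumr [X in _ *~ X](bigD1 j) //= eqxx.
by rewrite [X in _ *~ (_ + X)]big1 ?addr0 // => l /negPf ->; rewrite mul0r.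
Qed.

(** For [k] nonnegative this turns nonnegative coefficients on [b] into
    nonnegative coefficients on the shear: the cone can only grow. *)
Lemma zcomb_unshear (A : zmodType) (n : nat) (b : n.-tuple A) (i j : 'I_n)
    (k : int) (c : 'I_n -> int) :
  i != j ->
  zcomb b c =
  zcomb (shear b i j k) (fun l => c l + (if l == i then k * c j else 0)).
Proof.
move=> ij; rewrite zcomb_shear; apply: eq_zcomb => l.
by rewrite (eq_sym j) (negPf ij) addr0 addrK.
Qed.

Lemma zbasis_shear (A : zmodType) (L : set A) (n : nat) (b : n.-tuple A)
    (i j : 'I_n) (k : int) :
  subgroup L -> zbasis_of L b -> i != j -> zbasis_of L (shear b i j k).
Proof.
move=> Lg bL ij; have [Lb _] := bL; apply: zbasisI => [l|x Lx|m m'].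
- by rewrite tnth_shear; apply: Lg.2 => //; apply: subgroupMz.
- have [c ->] := zbasis_zcomb bL Lx.
  exists (fun l => c l + (if l == i then k * c j else 0)).
  exact: zcomb_unshear.
- rewrite !zcomb_shear => /(zcomb_inj Lg bL) mm' l.
  have mj : m j = m' j.
    by have := mm' j; rewrite (eq_sym j) (negPf ij) !subr0.
  by have := mm' l; rewrite mj; apply: addIr.
Qed.

(** The sheared vector is the only member of a shear of [b] whose coordinate
    on [b_j] is 1, and its coordinate on [b_i] is - k. *)
Lemma shear_member_inj (A : zmodType) (L : set A) (n : nat) (b : n.-tuple A)
    (i j l : 'I_n) (k k' : int) :
  subgroup L -> zbasis_of L b -> i != j ->
  tnth (shear b i j k) j = tnth (shear b i j k') l -> k = k'.
Proof.
move=> Lg bL ij; rewrite -[LHS]mulr1z -[RHS]mulr1z -!zcomb_single !zcomb_shear.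
move=> /(zcomb_inj Lg bL) coord.
have jl : j = l.
  apply/eqP; have := coord j.
  by rewrite eqxx (eq_sym j i) (negPf ij) !subr0; case: (j == l).
have := coord i.
by rewrite -jl (negPf ij) !eqxx !sub0r !mulr1; apply: oppr_inj.
Qed.

(** * Biadditive forms *)

Lemma form0l (A : zmodType) (form : A -> A -> rat) (y : A) :
  biadditive form -> form 0 y = 0.
Proof. by move=> [addl _]; apply: (addrI (form 0 y)); rewrite -addl !addr0. Qed.

Lemma formNl (A : zmodType) (form : A -> A -> rat) (x y : A) :
  biadditive form -> form (- x) y = - form x y.
Proof.
move=> fb; apply: (addrI (form x y)).
by rewrite -fb.1 !subrr form0l.
Qed.

Lemma formMzl (A : zmodType) (form : A -> A -> rat) (x y : A) (k : int) :
  biadditive form -> form (x *~ k) y = form x y *~ k.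
Proof.
move=> fb.
have fMn n : form (x *+ n) y = form x y *+ n.
  by elim: n => [|n IH]; rewrite ?mulr0n ?form0l // !mulrS fb.1 IH.
case: k => n; first by rewrite -!pmulrn fMn.
by rewrite !NegzE !mulrNz formNl // -!pmulrn fMn.
Qed.

Lemma radical_subgroup (A : zmodType) (form : A -> A -> rat) :
  biadditive form -> subgroup (radical form).
Proof.
move=> fb; split=> [y|x y rx ry z]; first exact: form0l.
by rewrite fb.1 formNl // rx ry subr0.
Qed.

Lemma form_pm_coset (A : zmodType) (form : A -> A -> rat) (eps alpha : A) :
  (forall x y, form x y = form y x) -> biadditive form ->
  form eps eps = 2%:R -> pm_coset eps (radical form) alpha ->
  form alpha alpha = 2%:R.
Proof.
move=> symf fb ee.
have sq x l : form x x = 2%:R -> radical form l -> form (x + l) (x + l) = 2%:R.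
  by move=> xx rl; rewrite fb.1 rl symf fb.1 rl !addr0.
case=> -[l rl <-]; apply: sq => //.
by rewrite formNl // symf formNl // opprK.
Qed.

(** * The Weyl group and isotropic sums *)

Lemma reflection_radicalP (A : zmodType) (form : A -> A -> rat) (nu : nat)
    (eps : A) (sigma : nu.-tuple A) (alpha : A) :
  (forall x y, form x y = form y x) -> biadditive form ->
  zbasis_of [set: A] [tuple of eps :: sigma] ->
  zbasis_of (radical form) sigma -> form eps eps = 2%:R ->
  pm_coset eps (radical form) alpha ->
  [/\ {morph reflection form alpha : x y / x + y},
      forall x, radical form x -> reflection form alpha x = x
    & forall x, radical form (reflection form alpha x) -> radical form x].
Proof.
move=> symf fb bA bL ee alphaP.
have aa := form_pm_coset symf fb ee alphaP.
pose c x := numq (2%:R * form x alpha / form alpha alpha).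
have cE x : (c x)%:~R = form x alpha.
  by rewrite /c (reflection_coefK _ symf fb bA bL ee alphaP) aa mulrC mulKf.
have wE x : reflection form alpha x = x - alpha *~ c x by [].
split=> [x y|x rx|x rwx].
- have cD : c (x + y) = c x + c y.
    by apply: (@intr_inj rat); rewrite intrD !cE fb.1.
  by rewrite !wE cD mulrzDr opprD addrACA.
- have c0 : c x = 0 by apply: (@intr_inj rat); rewrite cE rx.
  by rewrite wE c0 mulr0z subr0.
- (* Pairing the image with alpha negates the coefficient of x. *)
  have c0 : c x = 0.
    apply: (@intr_inj rat); have := rwx alpha.
    rewrite wE fb.1 formNl // formMzl // aa -mulrzr -cE mulr_natl mulr2n.
    by rewrite opprD addrA subrr sub0r => /eqP; rewrite oppr_eq0 => /eqP.
  by move: rwx; rewrite wE c0 mulr0z subr0.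
Qed.

Lemma weyl_radicalP (A : zmodType) (form : A -> A -> rat) (nu : nat)
    (eps : A) (sigma : nu.-tuple A) (w : A -> A) :
  (forall x y, form x y = form y x) -> biadditive form ->
  zbasis_of [set: A] [tuple of eps :: sigma] ->
  zbasis_of (radical form) sigma -> form eps eps = 2%:R ->
  weyl form eps w ->
  [/\ {morph w : x y / x + y},
      forall x, radical form x -> w x = x
    & forall x, radical form (w x) -> radical form x].
Proof.
move=> symf fb bA bL ee; elim=> {w}.
- by move=> alpha; exact: reflection_radicalP bA bL ee.
- by split.
- move=> f g _ [fD ff fr] _ [gD gf gr]; split=> /= [x y|x rx|x /fr/gr//].
    by rewrite /= gD fD.
  by rewrite gf // ff.
- move=> f g _ [fD ff fr] fK gK; split=> [x y|x rx|x rx].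
  + by apply: (can_inj fK); rewrite fD !gK.
  + by rewrite -[in LHS](ff _ rx) fK.
  + by rewrite -[x]gK ff.
Qed.

Definition isotropic_sums (A : zmodType) (L Pi : set A) : set A :=
  [set x + y | x in Pi & y in Pi] `&` L.

Lemma isotropic_sums_weyl (A : zmodType) (form : A -> A -> rat) (nu : nat)
    (eps : A) (sigma : nu.-tuple A) (w : A -> A) (Pi : set A) :
  (forall x y, form x y = form y x) -> biadditive form ->
  zbasis_of [set: A] [tuple of eps :: sigma] ->
  zbasis_of (radical form) sigma -> form eps eps = 2%:R ->
  weyl form eps w ->
  isotropic_sums (radical form) (w @` Pi) = isotropic_sums (radical form) Pi.
Proof.
move=> symf fb bA bL ee wW.
have [wD wfix wrad] := weyl_radicalP symf fb bA bL ee wW.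
rewrite eqEsubset; split=> z [].
- move=> [_ [x Px <-] [_ [y Py <-] <-]]; rewrite -wD => rz.
  by have rxy := wrad _ rz; split; rewrite ?wfix //; exists x => //; exists y.
- move=> [x Px [y Py <-]] rxy; split=> //.
  by exists (w x); [exists x | exists (w y); [exists y | rewrite -wD wfix]].
Qed.

Lemma eq_isotropic_sums (A : zmodType) (form : A -> A -> rat) (nu : nat)
    (eps : A) (sigma : nu.-tuple A) (Pi Pi' : set A) :
  (forall x y, form x y = form y x) -> biadditive form ->
  zbasis_of [set: A] [tuple of eps :: sigma] ->
  zbasis_of (radical form) sigma -> form eps eps = 2%:R ->
  weyl_orbit form eps Pi = weyl_orbit form eps Pi' ->
  isotropic_sums (radical form) Pi = isotropic_sums (radical form) Pi'.
Proof.
move=> symf fb bA bL ee orbE.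
have : weyl_orbit form eps Pi Pi.
  by exists id; [exact: weyl_id | rewrite image_id].
by rewrite orbE => -[w wW <-]; exact: isotropic_sums_weyl bA bL ee wW.
Qed.

(** * Root bases from bases of the radical *)

(** With eps at the head and - eps in every other member, the tau_i are recovered
    from the set of members alone, as their isotropic sums. *)
Definition lifted_basis (A : zmodType) (eps : A) (n : nat) (tau : n.-tuple A) :
    n.+1.-tuple A :=
  [tuple of eps :: [tuple - eps + tnth tau i | i < n]].

Lemma tnth_lifted_basis (A : zmodType) (eps : A) (n : nat) (tau : n.-tuple A)
    (i : 'I_n) :
  tnth (lifted_basis eps tau) (lift ord0 i) = - eps + tnth tau i.
Proof. by rewrite tnthS tnth_mktuple. Qed.

Lemma mem_lifted_basis (A : zmodType) (eps : A) (n : nat) (tau : n.-tuple A)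
    (x : A) :
  x \in lifted_basis eps tau ->
  x = eps \/ exists i, x = - eps + tnth tau i.
Proof.
rewrite inE => /orP [/eqP ->|/tnthP [i ->]]; first by left.
by right; exists i; rewrite tnth_mktuple.
Qed.

Lemma zcomb_lifted_basis (A : zmodType) (eps : A) (n : nat) (tau : n.-tuple A)
    (m : 'I_n.+1 -> int) :
  zcomb (lifted_basis eps tau) m =
  eps *~ (m ord0 - \sum_(i < n) m (lift ord0 i))
    + zcomb tau (fun i => m (lift ord0 i)).
Proof.
rewrite /zcomb big_ord_recl tnth0.
under eq_bigr do rewrite tnth_lifted_basis mulrzDl mulNrz.
by rewrite big_split sumrN /= addrA mulrzBr -mulrz_sumr.
Qed.

Lemma zcomb_lifted_basis_exists (A : zmodType) (eps : A) (n : nat)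
    (tau : n.-tuple A) (a : int) (c : 'I_n -> int) :
  let m l := if unlift ord0 l is Some i then c i else a + \sum_(i < n) c i in
  eps *~ a + zcomb tau c = zcomb (lifted_basis eps tau) m.
Proof.
move=> m; have mS i : m (lift ord0 i) = c i by rewrite /m liftK.
have m0 : m ord0 = a + \sum_(i < n) c i by rewrite /m unlift_none.
rewrite zcomb_lifted_basis (eq_bigr c) => [|i _]; last exact: mS.
by rewrite m0 addrK; congr (_ + _); apply: eq_zcomb => i; rewrite mS.
Qed.

Lemma zbasis_lifted_basis (A : zmodType) (form : A -> A -> rat) (nu : nat)
    (eps : A) (sigma tau : nu.-tuple A) :
  biadditive form -> zbasis_of [set: A] [tuple of eps :: sigma] ->
  zbasis_of (radical form) sigma -> form eps eps = 2%:R ->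
  zbasis_of (radical form) tau -> zbasis_of [set: A] (lifted_basis eps tau).
Proof.
move=> fb bA bL ee bT; have rad := radical_subgroup fb.
apply: zbasisI => // [x _|m m'].
- have [m ->] := zbasis_zcomb bA (I : [set: A] x).
  have -> : zcomb [tuple of eps :: sigma] m =
      eps *~ m ord0 + zcomb sigma (fun i => m (lift ord0 i)).
    rewrite /zcomb big_ord_recl tnth0; congr (_ + _).
    by apply: eq_bigr => i _; rewrite tnthS.
  have [c ->] := zbasis_zcomb bT
    (subgroup_zcomb (fun i => m (lift ord0 i)) rad bL.1).
  by rewrite zcomb_lifted_basis_exists; eexists.
- rewrite !zcomb_lifted_basis => E.
  (* Pairing with eps reads off the eps-coordinate. *)
  have coef (a : int) c : form (eps *~ a + zcomb tau c) eps = 2%:R *~ a.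
    rewrite fb.1 formMzl // ee (_ : form (zcomb tau c) eps = 0) ?addr0 //.
    exact: (subgroup_zcomb c rad bT.1).
  have E0 : m ord0 - \sum_(i < nu) m (lift ord0 i) =
      m' ord0 - \sum_(i < nu) m' (lift ord0 i).
    have two0 : 2%:R != 0 :> rat by [].
    have := congr1 (form^~ eps) E; rewrite /= !coef -!(mulrzr 2%:R).
    by move=> /(mulfI two0)/intr_inj.
  move: E; rewrite E0 => /addrI /(zcomb_inj rad bT) mS l.
  case: (unliftP ord0 l) => [i ->|->]; first exact: mS.
  move: E0; rewrite (eq_bigr (fun i => m' (lift ord0 i))) => [|i _].
    exact: addIr.
  exact: mS.
Qed.

Lemma isotropic_sums_lifted_basis (A : zmodType) (form : A -> A -> rat)
    (nu : nat) (eps : A) (tau : nu.-tuple A) :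
  biadditive form -> form eps eps = 2%:R ->
  (forall i, radical form (tnth tau i)) ->
  isotropic_sums (radical form) [set` lifted_basis eps tau] = [set` tau].
Proof.
move=> fb ee radT; rewrite eqEsubset; split=> z.
- move=> [[x /= xP [y /= yP <-]] /(_ eps)]; rewrite fb.1.
  have formN i : form (- eps + tnth tau i) eps = - 2%:R.
    by rewrite fb.1 formNl // ee radT addr0.
  case: (mem_lifted_basis xP) => [->|[i ->]];
    case: (mem_lifted_basis yP) => [->|[j ->]]; rewrite ?formN ?ee //.
  + by move=> _; rewrite addrA subrr add0r mem_tnth.
  + by move=> _; rewrite addrC addrA subrr add0r mem_tnth.
- move=> /= /tnthP [i ->]; split; last exact: radT.
  exists eps; first by rewrite /= inE eqxx.
  exists (- eps + tnth tau i); last by rewrite addrA subrr add0r.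
  by rewrite /= -tnth_lifted_basis mem_tnth.
Qed.

(** It is enough that the basis [tau] expresses nonnegative combinations of
    [sigma] as nonnegative combinations of [tau]: adding the multiple of eps
    that cancels the eps-coordinate costs one more nonnegative coefficient. *)
Lemma root_basis_lifted_basis (A : zmodType) (form : A -> A -> rat) (nu : nat)
    (eps : A) (sigma tau : nu.-tuple A) (S : set A) :
  biadditive form -> zbasis_of [set: A] [tuple of eps :: sigma] ->
  zbasis_of (radical form) sigma -> form eps eps = 2%:R ->
  zbasis_of (radical form) tau ->
  (forall i, base_semilattice (radical form) sigma (tnth tau i)) ->
  (forall c : 'I_nu -> int, (forall i, 0 <= c i) ->
    exists2 c', (forall i, 0 <= c' i) & zcomb sigma c = zcomb tau c') ->
  root_basis form eps sigma S [set` lifted_basis eps tau].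
Proof.
move=> fb bA bL ee bT Sb cone; exists (lifted_basis eps tau); split=> //.
- exact: zbasis_lifted_basis bA bL ee bT.
- have [r0 _] := radical_subgroup fb.
  move=> x /= /mem_lifted_basis [->|[i ->]]; split.
  + right; left; exists 0; last by rewrite addr0.
    exists 0; first by rewrite /= inE eqxx.
    by exists 0 => //; rewrite mul0rn addr0.
  + by move=> /(_ eps); rewrite ee.
  + by right; right; exists (tnth tau i).
  + by move=> /(_ eps); rewrite fb.1 formNl // ee bT.1 addr0.
- move=> x [_ _ [c c0 xE]]; have [c' c'0 cc'] := cone c c0.
  have /= E := zcomb_lifted_basis_exists eps tau 0 c'.
  eexists; last first.
    by rewrite xE -[LHS]/(zcomb sigma c) cc' -[LHS]add0r -(mulr0z eps) E.
  move=> l; case: (unliftP ord0 l) => [i ->|->]; first by rewrite liftK.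
  by rewrite unlift_none add0r sumr_ge0.
Qed.

Lemma root_basis_shear (A : zmodType) (form : A -> A -> rat) (nu : nat)
    (eps : A) (sigma : nu.-tuple A) (S : set A) (i j : 'I_nu) (k : nat) :
  biadditive form -> zbasis_of [set: A] [tuple of eps :: sigma] ->
  zbasis_of (radical form) sigma -> form eps eps = 2%:R -> i != j ->
  root_basis form eps sigma S
    [set` lifted_basis eps (shear sigma i j (2 * k)%N)].
Proof.
move=> fb bA bL ee ij; have rad := radical_subgroup fb.
apply: root_basis_lifted_basis => // [|l|c c0].
- exact: zbasis_shear.
- exists (tnth sigma l); first by rewrite /= inE mem_tnth orbT.
  exists (tnth sigma i *~ (if l == j then - k%:Z else 0)).
    exact: subgroupMz (bL.1 i).
  rewrite tnth_shear; congr (_ + _).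
  case: eqP => _; last by rewrite !mulr0z mul0rn oppr0.
  by rewrite mulrNz mulNrn PoszM mulrC mulrzA pmulrn.
- exists (fun l => c l + (if l == i then (2 * k)%N%:Z * c j else 0)).
    by move=> l; case: eqP => _; rewrite addr_ge0 // mulr_ge0.
  exact: zcomb_unshear.
Qed.

Theorem mainTheorem7 (A : zmodType) (form : A -> A -> rat) (nu : nat)
    (eps : A) (sigma : nu.-tuple A) (S : set A)
    (nu_gt1 : (1 < nu)%N)
    (form_sym : forall x y, form x y = form y x)
    (form_biadd : biadditive form)
    (form_psd : forall x, 0 <= form x x)
    (basisA : zbasis_of [set: A] [tuple of eps :: sigma])
    (basisL : zbasis_of (radical form) sigma)
    (form_eps : form eps eps = 2%:R)
    (S_semilattice : semilattice (radical form) S)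
    (sigma_S : forall i, S (tnth sigma i)) :
  ~ finite_set [set weyl_orbit form eps Pi | Pi in root_basis form eps sigma S].
Proof.
have rad := radical_subgroup form_biadd.
pose i := Ordinal (ltnW nu_gt1); pose j := Ordinal nu_gt1.
have ij : i != j by [].
pose tau k := shear sigma i j (2 * k)%N.
have bT k : zbasis_of (radical form) (tau k) by exact: zbasis_shear.
pose orbit k := weyl_orbit form eps [set` lifted_basis eps (tau k)].
have orbit_inj : injective orbit.
  move=> k k' /(eq_isotropic_sums form_sym form_biadd basisA basisL form_eps).
  rewrite !isotropic_sums_lifted_basis //; try exact: (bT _).1.
  move=> E; have : [set` tau k] (tnth (tau k) j) by exact: mem_tnth.
  rewrite E => /= /tnthP [l /(shear_member_inj rad basisL ij) [kk']].
  by apply/eqP; rewrite -(eqn_pmul2l (isT : 0 < 2)%N) kk'.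
move=> /(finite_preimage (f := orbit) (in2W orbit_inj)).
apply: sub_infinite_set infinite_nat => k _ /=.
by exists [set` lifted_basis eps (tau k)] => //; exact: root_basis_shear.
Qed.
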